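(* Let $t^\flat\in\mathbb R$, let $z^\flat=(q^\flat,p^\flat)\in\Upsilon$ be a non-degenerate conical crossing point with $dw(q^\flat)p^\flat=r\omega$, $r>0$, $|\omega|=1$, and let $\vec V_\omega\in\mathbb R^2$ satisfy $|\vec V_\omega|=1$ and $\begin{pmatrix}\omega_1&\omega_2\\ \omega_2&-\omega_1\end{pmatrix}\vec V_\omega=\vec V_\omega$. Let $\vec V_\omega^\perp$ be obtained from $\vec V_\omega$ by the rotation of angle $\frac\pi2$. Then there exist two families of eigenvectors $\vec Y_\pm(t)$ (that is, $\Pi_\pm(q_\pm(t))\vec Y_\pm(t)=\vec Y_\pm(t)$ for $t\neq t^\flat$, where $\Phi_\pm^{t,t^\flat}(z^\flat)=(q_\pm(t),p_\pm(t))$) defined in a neighborhood $I$ of $t^\flat$ such that $$\partial_t\vec Y_\pm(t)=B_\pm(\Phi_\pm^{t,t^\flat}(z^\flat))\vec Y_\pm(t),\qquad t\in I\setminus\{t^\flat\},$$ and $$\lim_{t\downarrow t^\flat}\vec Y_+(t)=\lim_{t\uparrow t^\flat}\vec Y_-(t)=\vec V_\omega,\qquad\lim_{t\downarrow t^\flat}\vec Y_-(t)=\lim_{t\uparrow t^\flat}\vec Y_+(t)=\vec V_\omega^\perp.$$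
   Context: $A(w)=\begin{pmatrix}w_1&w_2\\ w_2&-w_1\end{pmatrix}$ for $w\in\mathbb R^2$. $V(x)=v(x)\mathrm{Id}+A(w(x))$ with $v\in C^\infty(\mathbb R^d,\mathbb R)$, $w\in C^\infty(\mathbb R^d,\mathbb R^2)$, $\sup_x\|\partial^\gamma V(x)\|<\infty$ for $|\gamma|\ge2$; $\lambda_\pm=v\pm|w|$; there are $c_0,n_0,r_0>0$ with $|\lambda_+-\lambda_-|(x)\ge c_0\langle x\rangle^{-n_0}$ when $|w(x)|\ge r_0$. $\Upsilon=\{w=0\}$ (one says indifferently $q\in\Upsilon$ or $(q,p)\in\Upsilon$), and the $2\times d$ Jacobian $dw(q)$ has rank 2 at every $q\in\Upsilon$. $z^\flat=(q^\flat,p^\flat)\in\Upsilon$ is a non-degenerate conical crossing point if $dw(q^\flat)p^\flat\ne0$. Off $\Upsilon$: $\Pi_\pm=\frac12(\mathrm{Id}\pm\frac1{|w|}A(w))$ and $B_\pm(x,\xi)=\pm\Pi_\mp(x)(\xi\cdot\nabla_x\Pi_+(x))\Pi_\pm(x)$. $t\mapsto\Phi_\pm^{t,t^\flat}(z^\flat)=(q_\pm(t),p_\pm(t))$ denote the generalized trajectories: the continuous maps near $t^\flat$ with value $z^\flat$ at $t^\flat$, solving $\dot q=p$, $\dot p=-\nabla\lambda_\pm(q)$ for $t\neq t^\flat$, with $w(q_\pm(t))=(t-t^\flat)r\omega+O((t-t^\flat)^2)$ (their existence is a known result). *)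

(* Defs.v *)
From HB Require Import structures.
From mathcomp Require Import all_boot all_order all_algebra.
From mathcomp Require Import all_classical all_reals all_analysis.

Set Implicit Arguments.
Unset Strict Implicit.
Unset Printing Implicit Defensive.

Import Order.TTheory GRing.Theory Num.Theory numFieldNormedType.Exports.

Local Open Scope classical_set_scope.
Local Open Scope ring_scope.

(* Points, momenta and values of w are row vectors, so that the library's 'd
   and 'J apply; eigenvectors are column vectors. *)

(* The library norm on matrices is the sup norm, hence a separate Euclidean
   norm. *)
Definition enorm (R : realType) (m n : nat) (u : 'M[R]_(m, n)) : R :=
  Num.sqrt (\sum_i \sum_j u i j ^+ 2).

Definition japanese (R : realType) (d : nat) (x : 'rV[R]_d) : R :=
  Num.sqrt (1 + enorm x ^+ 2).

Definition partial (R : realType) (d : nat) (W : normedModType R)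
    (j : 'I_d) (f : 'rV[R]_d -> W) : 'rV[R]_d -> W :=
  fun x => 'D_(delta_mx 0 j) f x.

Definition mpartial (R : realType) (d : nat) (W : normedModType R)
    (gamma : 'I_d -> nat) (f : 'rV[R]_d -> W) : 'rV[R]_d -> W :=
  foldr (fun j g => iter (gamma j) (partial j) g) f (enum 'I_d).

Definition grad (R : realType) (d : nat) (f : 'rV[R]_d -> R)
    (x : 'rV[R]_d) : 'rV[R]_d :=
  \row_j partial j f x.

Fixpoint Ck (R : realType) (d : nat) (W : normedModType R) (k : nat)
    (f : 'rV[R]_d -> W) : Prop :=
  if k is k'.+1 then
    (forall x, differentiable f x) /\ (forall j, Ck k' (partial j f))
  else continuous f.

Definition smooth (R : realType) (d : nat) (W : normedModType R)
    (f : 'rV[R]_d -> W) : Prop :=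
  forall k, Ck k f.

Definition mx22 (R : realType) (a b c d : R) : 'M[R]_2 :=
  \matrix_(i < 2, j < 2)
    if i == 0 then (if j == 0 then a else b)
    else (if j == 0 then c else d).

Definition Amx (R : realType) (w : 'rV[R]_2) : 'M[R]_2 :=
  mx22 (w 0 0) (w 0 1) (w 0 1) (- w 0 0).

Definition rotation_mx (R : realType) (theta : R) : 'M[R]_2 :=
  mx22 (cos theta) (- sin theta) (sin theta) (cos theta).

(* The signs + and - of the modes are encoded by true and false. *)
Definition sgn (R : realType) (s : bool) : R := if s then 1 else - 1.

Section Potential.
Variables (R : realType) (d : nat).
Variables (v : 'rV[R]_d -> R) (w : 'rV[R]_d -> 'rV[R]_2).

Definition potential (x : 'rV[R]_d) : 'M[R]_2 := (v x)%:M + Amx (w x).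

Definition lam (s : bool) (x : 'rV[R]_d) : R := v x + sgn R s * enorm (w x).

Definition crossing_set : set 'rV[R]_d := [set q | w q = 0].

(* Meaningful only off the crossing set; on it the inverse of |w| is 0. *)
Definition Pimx (s : bool) (x : 'rV[R]_d) : 'M[R]_2 :=
  2^-1 *: (1%:M + (sgn R s / enorm (w x)) *: Amx (w x)).

Definition Bmx (s : bool) (x xi : 'rV[R]_d) : 'M[R]_2 :=
  sgn R s *:
    (Pimx (~~ s) x *m (\sum_j xi 0 j *: partial j (Pimx true) x) *m Pimx s x).

(* 'J w q is the transpose of the usual 2 x d Jacobian matrix. *)
Definition admissible_potential : Prop :=
  [/\ smooth v /\ smooth w,
      forall gamma : 'I_d -> nat, (2 <= \sum_j gamma j)%N ->
        exists C : R, forall x, `|mpartial gamma potential x| <= C,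
      exists c0 n0 r0 : R, [/\ 0 < c0, 0 < n0, 0 < r0 &
        forall x, r0 <= enorm (w x) ->
          c0 * japanese x `^ (- n0) <= `|lam true x - lam false x| ]
    & forall q, crossing_set q -> \rank ('J w q)^T = 2 ].

Definition nondegenerate_crossing (q p : 'rV[R]_d) : Prop :=
  crossing_set q /\ 'd w q p != 0.

(* Only the values of q and p near t0 matter. *)
Definition generalized_trajectory (s : bool) (t0 : R) (q0 p0 : 'rV[R]_d)
    (q p : R -> 'rV[R]_d) : Prop :=
  [/\ \forall t \near t0, continuous_at t q /\ continuous_at t p,
      q t0 = q0 /\ p t0 = p0,
      \forall t \near t0^',
        is_derive t (1 : R) q (p t) /\ is_derive t (1 : R) p (- grad (lam s) (q t))
    & exists C : R, \forall t \near t0,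
        enorm (w (q t) - (t - t0) *: 'd w q0 p0) <= C * (t - t0) ^+ 2 ].

Definition transported_eigenvectors (s : bool) (t0 : R) (I : set R)
    (q p : R -> 'rV[R]_d) (Y : R -> 'cV[R]_2) : Prop :=
  forall t, I t -> t != t0 ->
    Pimx s (q t) *m Y t = Y t /\ is_derive t (1 : R) Y (Bmx s (q t) (p t) *m Y t).

End Potential.

(* Main.v *)
Require Import Defs.
From HB Require Import structures.
From mathcomp Require Import all_boot all_order all_algebra.
From mathcomp Require Import all_classical all_reals all_analysis.
From mathcomp Require Import ring.

(* In the plane a unit eigenvector Y of the real symmetric matrix Pi_s along the
   trajectory is automatically parallel: Y' is orthogonal to Y, so
   Y' = Pi_s' Y = Pi_{-s} Pi_s' Pi_s Y, and p . grad Pi_+ (q) is the derivative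
   of Pi_+ along q, whence Y' = B_s Y. It therefore suffices to normalise
   Pi_s(q(t)) X for a constant vector X, separately on the two sides of the
   crossing time. Since w(q(t)) / |w(q(t))| tends to omega from the right and to
   -omega from the left, Pi_s(q(t)) X tends to X when X = V_omega (resp. its
   rotation) is chosen as a fixed vector of A(s omega) on the right and of
   A(-s omega) on the left. *)

Set Implicit Arguments.
Unset Strict Implicit.

Import Order.TTheory GRing.Theory Num.Theory numFieldNormedType.Exports.

Local Open Scope classical_set_scope.
Local Open Scope ring_scope.

(** * Derivatives of matrix-valued maps *)

Lemma is_derive_mxP (R : realType) (V : normedModType R) (m n : nat)
    (M : V -> 'M[R]_(m, n)) (t v : V) (dM : 'M[R]_(m, n)) :
  is_derive t v M dM <->
  forall i j, is_derive t v (fun x => M x i j) (dM i j).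
Proof.
split=> [[dMt <-] i j|dMt].
  apply: DeriveDef; first by move/derivable_mxP : dMt; apply.
  by rewrite derive_mx// mxE.
have Mt : derivable M t v by apply/derivable_mxP => i j; have [] := dMt i j.
apply: DeriveDef => //; rewrite derive_mx//; apply/matrixP => i j.
by rewrite mxE; have [] := dMt i j.
Qed.

(** Every entry of [Pimx], and every term of a matrix product with a constant factor, is brought to
    this affine shape before it is differentiated. *)
Lemma is_derive_affine (R : realType) (V : normedModType R) (c e : R)
    (f : V -> R) (t v : V) (f' : R) :
  is_derive t v f f' -> is_derive t v (fun x => c + e * f x) (e * f').
Proof.
move=> df; suff: is_derive t v (cst c + e \*: f) (e * f') by [].
by apply: is_derive_eq; rewrite add0r.
Qed.

Lemma is_derive_mulmxr (R : realType) (V : normedModType R) (m n p : nat)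
    (M : V -> 'M[R]_(m, n)) (X : 'M[R]_(n, p)) (t v : V) (dM : 'M[R]_(m, n)) :
  is_derive t v M dM -> is_derive t v (fun x => M x *m X) (dM *m X).
Proof.
move=> /is_derive_mxP dMt; apply/is_derive_mxP => i j.
rewrite (_ : (fun x => _) = \sum_k (fun x => 0 + X k j * M x i k)).
  have dk k := is_derive_affine 0 (X k j) (dMt i k).
  apply: (is_derive_eq (is_derive_sum dk)).
  by rewrite mxE; apply: eq_bigr => k _; rewrite mulrC.
apply/funext => x; rewrite mxE fct_sumE.
by apply: eq_bigr => k _; rewrite add0r mulrC.
Qed.

(** * The Euclidean norm and normalisation *)

Section Euclidean.
Variable R : realType.
Variables m n : nat.
Implicit Type u : 'M[R]_(m, n).

Lemma enorm0 : enorm (0 : 'M[R]_(m, n)) = 0.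
Proof.
rewrite /enorm big1 ?sqrtr0// => i _.
by rewrite big1// => j _; rewrite mxE expr0n.
Qed.

Lemma enormZ (c : R) u : enorm (c *: u) = `|c| * enorm u.
Proof.
rewrite /enorm -sqrtr_sqr -sqrtrM ?sqr_ge0//; congr (Num.sqrt _).
rewrite mulr_sumr; apply: eq_bigr => i _; rewrite mulr_sumr.
by apply: eq_bigr => j _; rewrite mxE exprMn.
Qed.

Lemma ler_entry_enorm u i j : `|u i j| <= enorm u.
Proof.
rewrite -sqrtr_sqr ler_sqrt; last first.
  by apply: sumr_ge0 => k _; apply: sumr_ge0 => l _; rewrite sqr_ge0.
rewrite (bigD1 i)//= (bigD1 j)//= -addrA lerDl.
rewrite addr_ge0//; first by apply: sumr_ge0 => l _; rewrite sqr_ge0.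
by apply: sumr_ge0 => k _; apply: sumr_ge0 => l _; rewrite sqr_ge0.
Qed.

Lemma enorm_ge0 u : 0 <= enorm u. Proof. exact: sqrtr_ge0. Qed.

Lemma enorm_eq0 u : (enorm u == 0) = (u == 0).
Proof.
apply/idP/idP => [/eqP u0|/eqP->]; last by rewrite enorm0.
apply/eqP/matrixP => i j; apply/eqP; rewrite mxE -normr_le0 -u0.
exact: ler_entry_enorm.
Qed.

Lemma cvg_enorm (T : Type) (F : set_system T) {FF : Filter F}
    (M : T -> 'M[R]_(m, n)) u : M @ F --> u -> enorm (M t) @[t --> F] --> enorm u.
Proof.
move=> Mu.
have su : \sum_i \sum_j M t i j ^+ 2 @[t --> F] --> \sum_i \sum_j u i j ^+ 2.
  apply: cvg_big => [|i _]; first exact: add_continuous.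
  apply: cvg_big => [|j _]; first exact: add_continuous.
  rewrite expr2; under eq_fun do rewrite expr2.
  by apply: cvgM; apply: (cvg_comp _ _ Mu (@coord_continuous _ _ _ i j _)).
exact: (cvg_comp _ _ su (@sqrt_continuous _ _)).
Qed.

Definition normalize u : 'M[R]_(m, n) := (enorm u)^-1 *: u.

(** Only the sign of the factor survives, which is how the two sides of the crossing come to see
    opposite directions. For [c = 0] both sides vanish. *)
Lemma normalizeZ (c : R) u : normalize (c *: u) = Num.sg c *: normalize u.
Proof.
rewrite /normalize enormZ invfM !scalerA; have [->|c0] := eqVneq c 0.
  by rewrite sgr0 mulr0 mul0r.
congr (_ *: _); rewrite mulrAC -normrV ?unitfE// {2}[c]numEsg.
by rewrite mulrCA normrV ?unitfE// mulVf ?normr_eq0// mulr1.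
Qed.

Lemma normalize_unit u : enorm u = 1 -> normalize u = u.
Proof. by rewrite /normalize => ->; rewrite invr1 scale1r. Qed.

Lemma cvg_normalize (T : Type) (F : set_system T) {FF : Filter F}
    (M : T -> 'M[R]_(m, n)) u :
  u != 0 -> M @ F --> u -> normalize (M t) @[t --> F] --> normalize u.
Proof.
move=> u0 Mu; apply: cvgZ => //; apply: cvgV; first by rewrite enorm_eq0.
exact: cvg_enorm.
Qed.

End Euclidean.

(** * Rotation of unit vectors in the plane *)

Lemma sum_ord2 (V : nmodType) (F : 'I_2 -> V) : \sum_i F i = F 0 + F 1.
Proof.
rewrite !big_ord_recl big_ord0 addr0; congr (_ + F _); exact/val_inj.
Qed.

Lemma ord2_ind (P : 'I_2 -> Prop) : P 0 -> P 1 -> forall i, P i.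
Proof.
move=> P0 P1 [[|[|//]] i2].
  by rewrite (_ : Ordinal i2 = 0)//; apply/val_inj.
by rewrite (_ : Ordinal i2 = 1)//; apply/val_inj.
Qed.

Lemma enorm_row2 (R : realType) (u : 'rV[R]_2) :
  enorm u = Num.sqrt (u 0 0 ^+ 2 + u 0 1 ^+ 2).
Proof. by rewrite /enorm big_ord1 sum_ord2. Qed.

Lemma enorm_col2 (R : realType) (u : 'cV[R]_2) :
  enorm u = Num.sqrt (u 0 0 ^+ 2 + u 1 0 ^+ 2).
Proof. by rewrite /enorm sum_ord2 !big_ord1. Qed.

(** A normalised plane vector can only turn: its derivative is its quarter turn times the angular
    velocity [(f g' - g f') / (f^2 + g^2)]. This is the first coordinate. *)
Lemma is_derive_unit2 (R : realType) (f g : R -> R) (t f' g' : R) :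
  0 < f t ^+ 2 + g t ^+ 2 ->
  is_derive t (1 : R) f f' -> is_derive t (1 : R) g g' ->
  is_derive t (1 : R) (fun x => (Num.sqrt (f x ^+ 2 + g x ^+ 2))^-1 * f x)
    (- ((f t * g' - g t * f') / (f t ^+ 2 + g t ^+ 2)) *
       ((Num.sqrt (f t ^+ 2 + g t ^+ 2))^-1 * g t)).
Proof.
move=> N0 df dg.
have dN : is_derive t (1 : R) (fun x => f x ^+ 2 + g x ^+ 2)
    (2 * (f t * f' + g t * g')).
  suff: is_derive t (1 : R) (f ^+ 2 + g ^+ 2) (2 * (f t * f' + g t * g')) by [].
  by apply: is_derive_eq; rewrite /GRing.scale/= expr1; ring.
have dS := @is_derive1_comp _ _ (fun x => f x ^+ 2 + g x ^+ 2) _ _ _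
  (is_derive1_sqrt N0) dN.
set S := Num.sqrt (f t ^+ 2 + g t ^+ 2) in dS *.
have S0 : S != 0 by rewrite gt_eqF// sqrtr_gt0.
have dI := is_deriveV (f := Num.sqrt \o (fun x => f x ^+ 2 + g x ^+ 2)) S0 dS.
apply: (is_derive_eq (is_deriveM dI df)).
have SS : f t ^+ 2 + g t ^+ 2 = S ^+ 2 by rewrite sqr_sqrtr// ltW.
rewrite /GRing.scale/= -/S SS.
(* After the rewriting with [SS], [field] no longer knows how [S] depends on [f t] and [g t].
   Reintroducing the sum of squares in this one term leaves an identity in which [S] is a free
   symbol. *)
have -> : S^-1 * f' = S ^- 3 * ((f t ^+ 2 + g t ^+ 2) * f') by rewrite SS; field.
by field.
Qed.

(** Exchanging [f] and [g] in the first coordinate reverses the sign of the angular velocity. *)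
Lemma is_derive_unit2_snd (R : realType) (f g : R -> R) (t f' g' : R) :
  0 < f t ^+ 2 + g t ^+ 2 ->
  is_derive t (1 : R) f f' -> is_derive t (1 : R) g g' ->
  is_derive t (1 : R) (fun x => (Num.sqrt (f x ^+ 2 + g x ^+ 2))^-1 * g x)
    ((f t * g' - g t * f') / (f t ^+ 2 + g t ^+ 2) *
       ((Num.sqrt (f t ^+ 2 + g t ^+ 2))^-1 * f t)).
Proof.
rewrite addrC => N0 df dg.
rewrite (_ : (fun x => _) =
  (fun x => (Num.sqrt (g x ^+ 2 + f x ^+ 2))^-1 * g x)); last first.
  by apply/funext => x; rewrite addrC.
apply: (is_derive_eq (is_derive_unit2 N0 dg df)).
by rewrite -mulNr opprB.
Qed.

(** Rows are multiplied on the right, so the quarter turn appears as the transpose of the matrix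
    that acts on columns. *)
Lemma is_derive_normalize_row2 (R : realType) (U : R -> 'rV[R]_2) (t : R)
    (dU : 'rV[R]_2) :
  U t != 0 -> is_derive t (1 : R) U dU ->
  is_derive t (1 : R) (fun x => normalize (U x))
    ((U t 0 0 * dU 0 1 - U t 0 1 * dU 0 0) / (U t 0 0 ^+ 2 + U t 0 1 ^+ 2) *:
      (normalize (U t) *m mx22 0 1 (-1) 0)).
Proof.
move=> U0 /is_derive_mxP dUt; apply/is_derive_mxP => i; rewrite ord1.
have N0 : 0 < U t 0 0 ^+ 2 + U t 0 1 ^+ 2.
  by rewrite -sqrtr_gt0 -enorm_row2 lt0r enorm_eq0 U0 enorm_ge0.
apply: ord2_ind.
  under eq_fun do rewrite mxE enorm_row2.
  apply: (is_derive_eq (is_derive_unit2 N0 (dUt _ _) (dUt _ _))).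
  by rewrite !mxE sum_ord2 !mxE/= enorm_row2; ring.
under eq_fun do rewrite mxE enorm_row2.
apply: (is_derive_eq (is_derive_unit2_snd N0 (dUt _ _) (dUt _ _))).
by rewrite !mxE sum_ord2 !mxE/= enorm_row2; ring.
Qed.

Lemma is_derive_normalize_col2 (R : realType) (U : R -> 'cV[R]_2) (t : R)
    (dU : 'cV[R]_2) :
  U t != 0 -> is_derive t (1 : R) U dU ->
  is_derive t (1 : R) (fun x => normalize (U x))
    ((U t 0 0 * dU 1 0 - U t 1 0 * dU 0 0) / (U t 0 0 ^+ 2 + U t 1 0 ^+ 2) *:
      (mx22 0 (-1) 1 0 *m normalize (U t))).
Proof.
move=> U0 /is_derive_mxP dUt; apply/is_derive_mxP => i j; rewrite ord1; move: i.
have N0 : 0 < U t 0 0 ^+ 2 + U t 1 0 ^+ 2.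
  by rewrite -sqrtr_gt0 -enorm_col2 lt0r enorm_eq0 U0 enorm_ge0.
apply: ord2_ind.
  under eq_fun do rewrite mxE enorm_col2.
  apply: (is_derive_eq (is_derive_unit2 N0 (dUt _ _) (dUt _ _))).
  by rewrite !mxE sum_ord2 !mxE/= enorm_col2; ring.
under eq_fun do rewrite mxE enorm_col2.
apply: (is_derive_eq (is_derive_unit2_snd N0 (dUt _ _) (dUt _ _))).
by rewrite !mxE sum_ord2 !mxE/= enorm_col2; ring.
Qed.

(** * Algebra and regularity of the eigenprojectors *)

Section Projector.
Context {R : realType} {d : nat}.
Variable w : 'rV[R]_d -> 'rV[R]_2.

Local Notation J := (mx22 0 (-1) 1 0 : 'M[R]_2).

(** The projector depends on [w x] only through its direction. On the crossing set both sides use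
    the convention that the inverse of 0 is 0. *)
Lemma PimxE s x :
  Pimx w s x = 2^-1 *: (1%:M + sgn R s *: Amx (normalize (w x))).
Proof.
congr (_ *: (_ + _)); apply/matrixP; apply: ord2_ind; apply: ord2_ind;
by rewrite !mxE/= ?mulrN mulrA.
Qed.

(** With constant matrices as a basis, differentiability and limits of [Amx] reduce to those of two
    scalar coefficients. *)
Lemma AmxE (u : 'rV[R]_2) :
  Amx u = u 0 0 *: mx22 1 0 0 (-1) + u 0 1 *: mx22 0 1 1 0.
Proof.
by apply/matrixP; apply: ord2_ind; apply: ord2_ind; rewrite !mxE/=; ring.
Qed.

Lemma AmxZ (c : R) (u : 'rV[R]_2) : Amx (c *: u) = c *: Amx u.
Proof. by rewrite !AmxE !mxE scalerDr !scalerA. Qed.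

Lemma differentiable_Pimx s x :
  differentiable w x -> w x != 0 -> differentiable (Pimx w s) x.
Proof.
move=> dw w0.
have dwi i j : differentiable (fun y => w y i j) x.
  exact: (differentiable_comp dw (differentiable_coord _ _ _)).
have N0 : 0 < w x 0 0 ^+ 2 + w x 0 1 ^+ 2.
  by rewrite -sqrtr_gt0 -enorm_row2 lt0r enorm_eq0 w0 enorm_ge0.
have d2 j : differentiable (fun y => w y 0 j ^+ 2) x.
  exact: (differentiableM (dwi 0 j) (dwi 0 j)).
have dS : differentiable (fun y => (enorm (w y))^-1) x.
  apply: differentiableV; last by rewrite enorm_eq0.
  under eq_fun do rewrite enorm_row2.
  apply: (@differentiable_comp _ _ _ _ (fun y => w y 0 0 ^+ 2 + w y 0 1 ^+ 2)).
    exact: (differentiableD (d2 0) (d2 1)).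
  by apply/derivable1_diffP; have [] := is_derive1_sqrt N0.
have dn j : differentiable (fun y => normalize (w y) 0 j) x.
  under eq_fun do rewrite mxE.
  exact: (differentiableM dS (dwi _ _)).
have -> : Pimx w s = fun y => 2^-1 *: (1%:M + sgn R s *:
    (normalize (w y) 0 0 *: mx22 1 0 0 (-1) + normalize (w y) 0 1 *: mx22 0 1 1 0)).
  by apply/funext => y; rewrite PimxE AmxE.
by apply: differentiableZ; apply: differentiableD => //; apply: differentiableZ;
  apply: differentiableD; apply: differentiableZl.
Qed.

Lemma sum_partialE (W : normedModType R) (F : 'rV[R]_d -> W)
    (x xi : 'rV[R]_d) :
  differentiable F x -> \sum_j xi 0 j *: partial j F x = 'd F x xi.
Proof.
move=> dF; rewrite {2}[xi]row_sum_delta linear_sum; apply: eq_bigr => j _.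
by rewrite linearZ/= /partial deriveE.
Qed.

Lemma sgn_sqr s : sgn R s * sgn R s = 1.
Proof. by case: s; rewrite /= ?mulrNN mulr1. Qed.

Lemma sgnN s : sgn R (~~ s) = - sgn R s.
Proof. by case: s; rewrite //= opprK. Qed.

Lemma normalize_sqr (u : 'rV[R]_2) :
  u != 0 -> normalize u 0 0 ^+ 2 + normalize u 0 1 ^+ 2 = 1.
Proof.
move=> u0; rewrite !mxE !exprMn -mulrDr exprVn.
rewrite -[X in _ * X]sqr_sqrtr ?addr_ge0 ?sqr_ge0// -enorm_row2.
by rewrite mulVf// expf_neq0// enorm_eq0.
Qed.

(** When the direction [k] turns, this identifies the resulting derivative of [Amx k], up to the
    angular velocity. *)
Lemma Amx_turn (k : 'rV[R]_2) : Amx (k *m mx22 0 1 (-1) 0) = J *m Amx k.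
Proof.
apply/matrixP; apply: ord2_ind; apply: ord2_ind;
by rewrite !mxE !sum_ord2 !mxE/=; ring.
Qed.

Lemma Amx_anti (k : 'rV[R]_2) : Amx k *m J = - (J *m Amx k).
Proof.
apply/matrixP; apply: ord2_ind; apply: ord2_ind;
by rewrite !mxE !sum_ord2 !mxE/=; ring.
Qed.

Lemma Amx_sqr (k : 'rV[R]_2) :
  Amx k *m Amx k = (k 0 0 ^+ 2 + k 0 1 ^+ 2)%:M.
Proof.
apply/matrixP; apply: ord2_ind; apply: ord2_ind;
by rewrite !mxE !sum_ord2 !mxE/=; ring.
Qed.

(** The quarter turn exchanges the two eigenlines, because it anticommutes with [Amx]. *)
Lemma Pimx_turn s x : Pimx w (~~ s) x *m J = J *m Pimx w s x.
Proof.
rewrite !PimxE sgnN -scalemxAl -scalemxAr; congr (_ *: _).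
rewrite mulmxDl mulmxDr mul1mx mulmx1 -scalemxAl -scalemxAr Amx_anti.
by rewrite scalerN scaleNr opprK.
Qed.

Lemma Amx_Pimx s x : w x != 0 ->
  Amx (normalize (w x)) *m Pimx w s x = sgn R s *: Pimx w s x.
Proof.
move=> w0; rewrite PimxE -scalemxAr mulmxDr mulmx1 -scalemxAr Amx_sqr.
rewrite normalize_sqr// [RHS]scalerA [_ * 2^-1]mulrC -[RHS]scalerA; congr (_ *: _).
by rewrite scalerDr scalerA sgn_sqr scale1r addrC.
Qed.

Lemma Pimx_idem s x : w x != 0 -> Pimx w s x *m Pimx w s x = Pimx w s x.
Proof.
move=> w0; rewrite {1}PimxE -scalemxAl mulmxDl mul1mx -scalemxAl Amx_Pimx//.
rewrite scalerA sgn_sqr scale1r -mulr2n.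
by rewrite -(scaler_nat 2 (Pimx w s x)) scalerA mulVf ?scale1r//.
Qed.

Lemma is_derive_curve (W : normedModType R) (F : 'rV[R]_d -> W)
    (q : R -> 'rV[R]_d) (t : R) (p : 'rV[R]_d) :
  differentiable F (q t) -> is_derive t (1 : R) q p ->
  is_derive t (1 : R) (fun x => F (q x)) ('d F (q t) p).
Proof.
move=> dF [dq <-]; have dq' := (derivable1_diffP _ _).1 dq.
have dFq : differentiable (F \o q) t by exact: differentiable_comp.
apply: DeriveDef; first exact/derivable1_diffP.
by rewrite deriveE// diff_comp//= deriveE.
Qed.

(** * Parallel transport along a curve off the crossing set *)

Section Transport.
Variables (q : R -> 'rV[R]_d) (t : R) (p : 'rV[R]_d).
Hypotheses (dw : differentiable w (q t)) (w0 : w (q t) != 0).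
Hypothesis (dq : is_derive t (1 : R) q p).

(* [theta] is the angular velocity of [w (q t)]. *)
Lemma is_derive_Pimx_curve : exists theta : R, forall s,
  is_derive t (1 : R) (fun x => Pimx w s (q x))
    ((sgn R s * theta / 2) *: (J *m Amx (normalize (w (q t))))).
Proof.
have dk := is_derive_normalize_row2 w0 (is_derive_curve dw dq).
set theta := (_ / _) in dk; exists theta => s.
move/is_derive_mxP : dk => dk.
have -> : (fun x => Pimx w s (q x)) = (fun x => 2^-1 *: (1%:M + sgn R s *:
    Amx (normalize (w (q x))))) by apply/funext => x; rewrite PimxE.
set U := fun x => normalize (w (q x)).
(* Undoing [Amx_turn] writes the derivative as [Amx] of a turned direction, so that each entry
   follows from one entry of [dk]. *)
rewrite -Amx_turn; apply/is_derive_mxP; apply: ord2_ind; apply: ord2_ind.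
- rewrite (_ : (fun x => _) = fun x => 2^-1 + sgn R s / 2 * U x 0 0).
    apply: (is_derive_eq (is_derive_affine _ _ (dk 0 0))).
    by rewrite !mxE/=; ring.
  by apply/funext => x; rewrite [LHS]mxE [X in _ * X]mxE !mxE/=; ring.
- rewrite (_ : (fun x => _) = fun x => 0 + sgn R s / 2 * U x 0 1).
    apply: (is_derive_eq (is_derive_affine _ _ (dk 0 1))).
    by rewrite !mxE/=; ring.
  by apply/funext => x; rewrite !mxE/=; ring.
- rewrite (_ : (fun x => _) = fun x => 0 + sgn R s / 2 * U x 0 1).
    apply: (is_derive_eq (is_derive_affine _ _ (dk 0 1))).
    by rewrite !mxE/=; ring.
  by apply/funext => x; rewrite !mxE/=; ring.
- rewrite (_ : (fun x => _) = fun x => 2^-1 + - (sgn R s / 2) * U x 0 0).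
    apply: (is_derive_eq (is_derive_affine _ _ (dk 0 0))).
    by rewrite !mxE/=; ring.
  by apply/funext => x; rewrite !mxE/=; ring.
Qed.

(** Moving the left projector through [J] turns it into [Pimx w s], and [Amx] then acts on the range
    of [Pimx w s] as the sign of [s]. This sign cancels the one in front of [Bmx], hence the same
    angular velocity [theta / 2] for both modes. *)
Lemma BmxE theta s :
  is_derive t (1 : R) (fun x => Pimx w true (q x))
    ((sgn R true * theta / 2) *: (J *m Amx (normalize (w (q t))))) ->
  Bmx w s (q t) p = (theta / 2) *: (J *m Pimx w s (q t)).
Proof.
move=> dP; rewrite /Bmx sum_partialE; last exact: differentiable_Pimx.
have := is_derive_curve (differentiable_Pimx true dw w0) dq.
move=> [_ <-]; have [_ ->] := dP.
move: (Pimx_turn s (q t)) (Amx_Pimx s w0) (Pimx_idem s w0).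
move: (Pimx w s (q t)) (Pimx w (~~ s) (q t)) (Amx _) => P Q A QJ AP PP.
rewrite -scalemxAr -scalemxAl scalerA mulmxA QJ -!mulmxA AP -!scalemxAr PP.
by rewrite scalerA /= mul1r mulrAC sgn_sqr mul1r.
Qed.

(** The derivative of a normalised vector and the action of [Bmx] on an eigenvector are both
    multiples of its quarter turn, so only two scalar angular velocities have to agree. *)
Lemma transport_Pimx s (X : 'cV[R]_2) : Pimx w s (q t) *m X != 0 ->
  is_derive t (1 : R) (fun x => normalize (Pimx w s (q x) *m X))
    (Bmx w s (q t) p *m normalize (Pimx w s (q t) *m X)).
Proof.
move=> Z0; have [theta dP] := is_derive_Pimx_curve.
rewrite (BmxE _ (dP true)).
have dZ : is_derive t (1 : R) (fun x => Pimx w s (q x) *m X)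
   ((sgn R s * theta / 2) *: (J *m Amx (normalize (w (q t)))) *m X).
  exact: is_derive_mulmxr.
apply: (is_derive_eq (is_derive_normalize_col2 Z0 dZ)).
have PY : Pimx w s (q t) *m normalize (Pimx w s (q t) *m X) =
    normalize (Pimx w s (q t) *m X).
  by rewrite {1}/normalize -scalemxAr mulmxA Pimx_idem.
rewrite -[RHS]scalemxAl -[in RHS]mulmxA PY; congr (_ *: _).
set Z := Pimx w s (q t) *m X in Z0 *.
have N0 : Z 0 0 ^+ 2 + Z 1 0 ^+ 2 != 0.
  by rewrite gt_eqF// -sqrtr_gt0 -enorm_col2 lt0r enorm_eq0 Z0 enorm_ge0.
apply: (canLR (mulfK N0)).
(* The frame of eigenvectors turns at half the angular velocity of [w (q t)]. *)
have := normalize_sqr w0; rewrite /Z PimxE.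
move: (normalize _) => k k1.
rewrite !mxE !sum_ord2 !mxE !sum_ord2 !mxE/=.
apply/eqP; rewrite -subr_eq0; apply/eqP.
(* The two sides differ by a multiple of [|k|^2 - 1], which vanishes since [k] is a unit vector. *)
transitivity (theta / 8 * (X 0 0 ^+ 2 + X 1 0 ^+ 2) *
    (k 0 0 ^+ 2 + k 0 1 ^+ 2 - 1)); last by rewrite k1 subrr mulr0.
by case: s {dZ PY Z Z0 N0} => /=; field.
Qed.

End Transport.

(** * Limits of the eigenvectors at the crossing time *)

Lemma cvg_Pimx_mulmx (T : Type) (F : set_system T) {FF : Filter F}
    (q : T -> 'rV[R]_d) (s : bool) (u : 'rV[R]_2) (X : 'cV[R]_2) :
  Amx (sgn R s *: u) *m X = X -> normalize (w (q t)) @[t --> F] --> u ->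
  Pimx w s (q t) *m X @[t --> F] --> X.
Proof.
move=> uX wu.
have cu j : normalize (w (q t)) 0 j @[t --> F] --> u 0 j.
  exact: (cvg_comp _ _ wu (@coord_continuous _ _ _ 0 j _)).
pose E1 := mx22 1 0 0 (-1) *m X : 'cV[R]_2.
pose E2 := mx22 0 1 1 0 *m X : 'cV[R]_2.
(* Since [X] is fixed by [Amx (sgn R s *: u)], it equals its image under the limiting projector;
   written over [E1] and [E2], the limit concerns scalar coefficients only. *)
have {2}-> : X = 2^-1 *: (X + sgn R s *: (u 0 0 *: E1 + u 0 1 *: E2)).
  rewrite !scalemxAl -mulmxDl -AmxE scalemxAl.
  by rewrite -AmxZ uX -mulr2n -(scaler_nat 2 X) scalerA mulVf ?scale1r// pnatr_eq0.
under eq_fun do rewrite PimxE AmxE -scalemxAl mulmxDl mul1mx -scalemxAl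
  mulmxDl -!scalemxAl.
apply: cvgZ; first exact: cvg_cst.
apply: cvgD; first exact: cvg_cst.
apply: cvgZ; first exact: cvg_cst.
by apply: cvgD; apply: cvgZ => //; exact: cvg_cst.
Qed.

Lemma transported_eigenvectors_exist (s : bool) (tb : R) (q p : R -> 'rV[R]_d)
    (omega : 'rV[R]_2) (Xr Xl : 'cV[R]_2) :
  (forall x, differentiable w x) ->
  (\forall t \near tb^', is_derive t (1 : R) q (p t)) ->
  (\forall t \near tb^', w (q t) != 0) ->
  normalize (w (q t)) @[t --> tb^'+] --> omega ->
  normalize (w (q t)) @[t --> tb^'-] --> - omega ->
  enorm Xr = 1 -> Amx (sgn R s *: omega) *m Xr = Xr ->
  enorm Xl = 1 -> Amx (sgn R s *: - omega) *m Xl = Xl ->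
  exists (I : set R) (Y : R -> 'cV[R]_2),
    [/\ nbhs tb I, transported_eigenvectors w s tb I q p Y,
        Y t @[t --> tb^'+] --> Xr & Y t @[t --> tb^'-] --> Xl].
Proof.
move=> dw dq w0 wr wl Xr1 eXr Xl1 eXl.
have X0 (X : 'cV[R]_2) : enorm X = 1 -> X != 0.
  by move=> X1; rewrite -enorm_eq0 X1 oner_eq0.
have Pr : Pimx w s (q t) *m Xr @[t --> tb^'+] --> Xr.
  exact: cvg_Pimx_mulmx eXr wr.
have Pl : Pimx w s (q t) *m Xl @[t --> tb^'-] --> Xl.
  exact: cvg_Pimx_mulmx eXl wl.
have nr : \forall t \near tb^'+, Pimx w s (q t) *m Xr != 0.
  exact: cvgr_neq0 Pr (X0 _ Xr1).
have nl : \forall t \near tb^'-, Pimx w s (q t) *m Xl != 0.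
  exact: cvgr_neq0 Pl (X0 _ Xl1).
have eig (X : 'cV[R]_2) t : w (q t) != 0 ->
    Pimx w s (q t) *m normalize (Pimx w s (q t) *m X) =
    normalize (Pimx w s (q t) *m X).
  by move=> wt; rewrite {1}/normalize -scalemxAr mulmxA Pimx_idem.
(* The condition is void at [tb], so properties valid on punctured or one-sided neighbourhoods
   suffice to make this set a neighbourhood of [tb]. *)
exists [set t | t != tb -> [/\ is_derive t (1 : R) q (p t), w (q t) != 0,
  tb < t -> Pimx w s (q t) *m Xr != 0 & t < tb -> Pimx w s (q t) *m Xl != 0]].
(* At [tb] itself the left formula applies; neither the transport condition nor the one-sided limits
   see this value. *)
exists (fun t => normalize (Pimx w s (q t) *m if tb < t then Xr else Xl)).
split.
- rewrite /dnbhs /at_right /at_left /within/= in dq w0 nr nl.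
  near=> t => /= ttb; split.
  + by move: ttb; near: t; exact: dq.
  + by move: ttb; near: t; exact: w0.
  + by near: t; exact: nr.
  + by near: t; exact: nl.
- move=> t /= It ttb; have [dqt wt ntr ntl] := It ttb; split; first exact: eig.
  have [tbt|ttb'|/eqP] := ltgtP tb t; last by rewrite eq_sym (negPf ttb).
  (* Near a time other than [tb] the test [tb < t] keeps its value, so [Y] coincides there with a
     single normalised projection. *)
  + apply: near_eq_is_derive (transport_Pimx (dw _) wt dqt (ntr tbt)).
    near=> x; suff -> : tb < x by [].
    by near: x; exact: (cvgr_gt t).
  + apply: near_eq_is_derive (transport_Pimx (dw _) wt dqt (ntl ttb')).
    near=> x; suff -> : tb < x = false by [].
    by apply/negbTE; rewrite -leNgt ltW//; near: x; exact: (cvgr_lt t).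
- rewrite -[X in _ --> X](normalize_unit Xr1).
  apply: cvg_trans (cvg_normalize (X0 _ Xr1) Pr); apply: near_eq_cvg.
  by near=> t; suff -> : tb < t by []; near: t; exact: nbhs_right_gt.
- rewrite -[X in _ --> X](normalize_unit Xl1).
  apply: cvg_trans (cvg_normalize (X0 _ Xl1) Pl); apply: near_eq_cvg.
  near=> t; suff -> : tb < t = false by [].
  by apply/negbTE; rewrite -leNgt ltW//; near: t; exact: nbhs_left_lt.
Unshelve. all: by end_near. Qed.

End Projector.

(** * The direction of [w] at the crossing *)

Lemma ler_norm_enorm (R : realType) (m n : nat) (u : 'M[R]_(m, n)) :
  `|u| <= enorm u.
Proof.
rewrite [leLHS]/Num.Def.normr/= mx_normrE (bigmax_le _ (enorm_ge0 u))//= => i _.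
exact: ler_entry_enorm.
Qed.

(** The quotient of [W t] by [t - tb] has the two-sided limit [r *: omega]. Normalisation then
    forgets [r] and keeps only the sign of [t - tb], which gives opposite one-sided limits. *)
Lemma cvg_direction (R : realType) (m n : nat) (W : R -> 'M[R]_(m, n)) (tb r C : R)
    (omega : 'M[R]_(m, n)) :
  0 < r -> enorm omega = 1 ->
  (\forall t \near tb, enorm (W t - (t - tb) *: (r *: omega)) <= C * (t - tb) ^+ 2) ->
  [/\ \forall t \near tb^', W t != 0,
      normalize (W t) @[t --> tb^'+] --> omega &
      normalize (W t) @[t --> tb^'-] --> - omega].
Proof.
move=> r0 omega1 WC.
pose M t := (t - tb)^-1 *: W t.
have romega0 : r *: omega != 0.
  by rewrite -enorm_eq0 enormZ omega1 mulr1 normr_eq0 gt_eqF.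
have WM t : t != tb -> W t = (t - tb) *: M t.
  by move=> ttb; rewrite scalerA mulfV ?subr_eq0// scale1r.
have cM : M t @[t --> tb^'] --> r *: omega.
  apply/cvgrPdist_le => /= e e0; near=> t.
  have ttb : t != tb by near: t; exact: nbhs_dnbhs_neq.
  have ttb0 : 0 < `|t - tb| by rewrite normr_gt0 subr_eq0.
  rewrite distrC (le_trans (ler_norm_enorm _))//.
  have -> : M t - r *: omega = (t - tb)^-1 *: (W t - (t - tb) *: (r *: omega)).
    by rewrite /M scalerBr (scalerA (t - tb)^-1) mulVf ?subr_eq0// scale1r.
  rewrite enormZ normfV mulrC ler_pdivrMr//.
  apply: (@le_trans _ _ (C * (t - tb) ^+ 2)); first by near: t; exact: nbhs_dnbhs.
  rewrite -real_normK ?num_real// expr2 mulrA ler_wpM2r//.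
  (* The sign of [C] is unknown; [|C| + 1] bounds it and is positive, so [e] can be divided by
     it. *)
  apply: (@le_trans _ _ ((`|C| + 1) * `|t - tb|)).
    by rewrite ler_wpM2r// (le_trans (ler_norm _))// lerDl.
  rewrite mulrC -ler_pdivlMr ?ltr_wpDl//.
  rewrite distrC; near: t; apply: nbhs_dnbhs.
  have [] := (cvgrPdist_le (F := nbhs tb) id tb).
  by move=> + _; apply; [exact: cvg_id|rewrite divr_gt0// ltr_wpDl].
have nM : normalize (r *: omega) = omega.
  by rewrite normalizeZ gtr0_sg// scale1r normalize_unit.
split.
- have M0 : \forall t \near tb^', M t != 0 by exact: cvgr_neq0 cM romega0.
  near=> t; have ttb : t != tb by near: t; exact: nbhs_dnbhs_neq.
  rewrite (WM _ ttb) scaler_eq0 subr_eq0 (negPf ttb)/=.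
  by near: t; exact: M0.
- rewrite -nM.
  apply: cvg_trans (cvg_normalize romega0 (cvg_dnbhs_at_right cM)).
  apply: near_eq_cvg; near=> t.
  have tbt : tb < t by near: t; exact: nbhs_right_gt.
  by rewrite (WM t) ?gt_eqF// (normalizeZ (t - tb)) gtr0_sg ?subr_gt0// scale1r.
- rewrite -nM.
  apply: cvg_trans (cvgN (cvg_normalize romega0 (cvg_dnbhs_at_left cM))).
  apply: near_eq_cvg; near=> t.
  have tbt : t < tb by near: t; exact: nbhs_left_lt.
  by rewrite (WM t) ?lt_eqF// (normalizeZ (t - tb)) ltr0_sg ?subr_lt0// scaleN1r.
Unshelve. all: by end_near. Qed.

(** * The quarter turn and the choice of limits *)

Lemma rotation_half (R : realType) : rotation_mx (pi / 2 : R) = mx22 0 (-1) 1 0.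
Proof. by rewrite /rotation_mx cos_pihalf sin_pihalf. Qed.

Lemma enorm_rotation (R : realType) (X : 'cV[R]_2) :
  enorm (rotation_mx (pi / 2) *m X) = enorm X.
Proof.
rewrite rotation_half !enorm_col2 !mxE !sum_ord2 !mxE/=.
by congr (Num.sqrt _); ring.
Qed.

(** By anticommutation with [Amx u], the quarter turn sends the eigenvalue 1 of [Amx u] to the
    eigenvalue 1 of [Amx (- u)]. *)
Lemma Amx_rotation (R : realType) (u : 'rV[R]_2) (X : 'cV[R]_2) :
  Amx u *m X = X ->
  Amx (- u) *m (rotation_mx (pi / 2) *m X) = rotation_mx (pi / 2) *m X.
Proof.
move=> uX; rewrite -scaleN1r AmxZ scaleN1r rotation_half mulmxA mulNmx.
by rewrite Amx_anti opprK -mulmxA uX.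
Qed.

Theorem proposition1p5 (R : realType) (d : nat)
    (v : 'rV[R]_d -> R) (w : 'rV[R]_d -> 'rV[R]_2)
    (hV : admissible_potential v w)
    (tb : R) (qb pb : 'rV[R]_d)
    (hz : nondegenerate_crossing w qb pb)
    (r : R) (omega : 'rV[R]_2)
    (hr : 0 < r) (homega : enorm omega = 1)
    (hdw : 'd w qb pb = r *: omega)
    (Vomega : 'cV[R]_2)
    (hVnorm : enorm Vomega = 1) (hVeig : Amx omega *m Vomega = Vomega)
    (qplus pplus qminus pminus : R -> 'rV[R]_d)
    (hplus : generalized_trajectory v w true tb qb pb qplus pplus)
    (hminus : generalized_trajectory v w false tb qb pb qminus pminus) :
  exists (I : set R) (Yplus Yminus : R -> 'cV[R]_2),
    [/\ nbhs tb I,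
        transported_eigenvectors w true tb I qplus pplus Yplus,
        transported_eigenvectors w false tb I qminus pminus Yminus,
        (Yplus t @[t --> tb^'+] --> Vomega)
          /\ (Yminus t @[t --> tb^'-] --> Vomega)
      & (Yminus t @[t --> tb^'+] --> rotation_mx (pi / 2) *m Vomega)
          /\ (Yplus t @[t --> tb^'-] --> rotation_mx (pi / 2) *m Vomega) ].

Proof.
have dw x : differentiable w x by case: hV => -[_ /(_ 1%N)[]].
have lim_dir q p s : generalized_trajectory v w s tb qb pb q p ->
    [/\ \forall t \near tb^', is_derive t (1 : R) q (p t),
        \forall t \near tb^', w (q t) != 0,
        normalize (w (q t)) @[t --> tb^'+] --> omega &
        normalize (w (q t)) @[t --> tb^'-] --> - omega].
  move=> [_ _ dqp [C]]; rewrite hdw => /(cvg_direction hr homega)[w0 wr wl].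
  by split=> //; apply: filterS dqp => t [].
have [dqp wp0 wpr wpl] := lim_dir _ _ _ hplus.
have [dqm wm0 wmr wml] := lim_dir _ _ _ hminus.
have rot1 : enorm (rotation_mx (pi / 2) *m Vomega) = 1 by rewrite enorm_rotation.
have rotA := Amx_rotation hVeig.
(* For the upper mode the limiting direction is [omega] on the right and [- omega] on the left,
   which selects [Vomega] and then its rotation. *)
have [||Ip [Yp [nIp trp rp lp]]] :=
    transported_eigenvectors_exist dw dqp wp0 wpr wpl hVnorm _ rot1 (s := true).
- by rewrite scale1r.
- by rewrite scale1r.
(* For the lower mode the sign reverses both directions, so the two vectors exchange sides. *)
have [||Im [Ym [nIm trm rm lm]]] :=
    transported_eigenvectors_exist dw dqm wm0 wmr wml rot1 _ hVnorm (s := false).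
- by rewrite scaleN1r.
- by rewrite scaleN1r opprK.
exists (Ip `&` Im), Yp, Ym; split => //; first exact: filterI.
- by move=> t [It _]; exact: trp.
- by move=> t [_ It]; exact: trm.
Qed.
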